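(* If $G$ is a $k$-connected graph on $n$ vertices with $k=\omega(\log n)$, then $G$ contains a spanning bipartite subgraph which is $\Omega(k)$-connected.
   Context: All graphs are finite and simple. A graph is $r$-connected ($r>0$ real) if it has more than $r$ vertices and remains connected after the removal of any set of fewer than $r$ vertices. Asymptotic notation is with respect to $n\to\infty$: $k=\omega(\log n)$ means $k/\log n\to\infty$; the constant hidden in $\Omega(\cdot)$ is an absolute positive constant; the statement is for all sufficiently large $n$ (where how large may depend only on the rate of divergence in the $\omega(\cdot)$ hypothesis). *)

(* Defs.v *)
From mathcomp Require Import all_boot all_order all_algebra.
From mathcomp Require Import reals.

Set Implicit Arguments.
Unset Strict Implicit.
Unset Printing Implicit Defensive.

Import Order.TTheory GRing.Theory Num.Theory.

Local Open Scope ring_scope.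

(* The vertex set is all of [T], so any [H G : sgraph T] with edges of [H]
   among those of [G] make [H] a spanning subgraph of [G]. *)
Record sgraph (T : finType) := SGraph {
  adj :> rel T;
  adj_sym : symmetric adj;
  adj_irrefl : irreflexive adj
}.

Definition spanning_subgraph (T : finType) (H G : sgraph T) : Prop :=
  subrel H G.

Definition bipartite (T : finType) (G : sgraph T) : Prop :=
  exists A : {set T}, forall x y : T, G x y -> (x \in A) != (y \in A).

Definition del_vertices (T : finType) (G : sgraph T) (S : {set T}) : rel T :=
  [rel x y | [&& x \notin S, y \notin S & G x y]].

Definition connected_without (T : finType) (G : sgraph T) (S : {set T}) : Prop :=
  forall x y : T, x \notin S -> y \notin S -> connect (del_vertices G S) x y.

(* The connectivity parameter [r] is a positive real, not necessarily an
   integer. *)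
Definition r_connected (R : realType) (T : finType) (r : R) (G : sgraph T) :
    Prop :=
  [/\ 0 < r, r < #|T|%:R
    & forall S : {set T}, #|S|%:R < r -> connected_without G S].

(* Main.v *)
Require Import Defs.
From mathcomp Require Import all_boot all_order all_algebra.
From mathcomp Require Import polyrcf.
From mathcomp Require Import zify ring lra.

(** A bipartite spanning subgraph is given by a 2-colouring of the vertices: keep
    the edges whose ends differ in colour. A uniformly random colouring need not
    work: if [G] is itself bipartite, its random cut graph splits into the part
    that agrees with the bipartition of [G] and the part that disagrees with it.
    But this is the only obstruction. With high probability, deleting any few
    vertices leaves at most two components ([good_colouring]), and a colouring
    with this property can be repaired ([robust_after_flip]): if deleting a small
    set [S] separates [X] from [Y], exchange the two colours on [X]. The edges
    of [G] between [X] and [Y] were all monochromatic, so all of them now cross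
    the cut, while nothing changes inside [X] and inside [Y]; the vertices of
    [S] are recoloured so that each has many neighbours of the other colour.
    Since [G] is highly connected, so is the new cut graph.

    To avoid a union bound over deleted sets, some vertices are left uncoloured
    at random: uncoloured with probability [1/2], each colour with probability
    [1/4]. If a full colouring has at least three components after deleting [S],
    then with probability at least [(1/2)^(|S|+3)] the random partial
    colouring obtained from it uncolours [S] and keeps one vertex from each of
    three components ([thinning_lower]). So it is enough that a random partial
    colouring has more than two components with probability exponentially
    small in [k], up to a factor polynomial in [n] ([many_components_rare]).

    For this, let the probability [p] of each colour grow from [1/8] to [1/4]
    and follow the expectation of the excess, the number of components beyond
    two. By Russo's formula ([russo]) its derivative is governed by the effect
    of colouring one more vertex, which glues together all components
    that meet its neighbourhood in the other colour. If each component but two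
    has at least [alpha] vertices that would glue it to another one, the
    expected excess decays at rate proportional to [alpha], hence exponentially
    in [alpha], starting from at most [n] ([excess_drop], [poly_decay]).

    It remains to find these gluing vertices, outside an event of probability
    [O(n) 2^-alpha]. Exploring the component [C] of a vertex reveals the colours
    on [C], restricts the colours of its neighbours to a product set and reveals
    nothing about the vertices far from [C]. If there are many far vertices,
    connectivity of [G] gives a large matching between the neighbours of [C] and
    the vertices far from [C], and each of its edges independently has
    a constant chance to yield a gluing vertex ([escape_fails]). If three
    components have few far vertices, almost every uncoloured vertex is adjacent
    to all three; two of the three neighbours found share a colour, so the
    vertex can glue two of the three components together. Hence at most two
    components lack gluing vertices ([card_stuck]), which is why the excess
    counts from two. *)

Set Implicit Arguments.
Unset Strict Implicit.
Unset Printing Implicit Defensive.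

Import Order.TTheory GRing.Theory Num.Theory.

(** * Product weights and a Chernoff bound for disjoint blocks *)

Section Mass.
Local Open Scope ring_scope.
Variables (R : realFieldType) (T S : finType).
Implicit Types (h : T -> S -> R) (f : {ffun T -> S}) (P J : {set {set T}}).

Definition mass h f : R := \prod_x h x (f x).

Lemma sum_mass h : \sum_f mass h f = \prod_x \sum_s h x s.
Proof. by rewrite bigA_distr_bigA. Qed.

Lemma mass_ge0 h f : (forall x s, 0 <= h x s) -> 0 <= mass h f.
Proof. by move=> h0; apply: prodr_ge0. Qed.

(** Disjoint blocks are independent under a product weight. Expanding the product
    over subfamilies [J] of [P] turns each term into a constraint on single
    coordinates, so that the sum over [f] factors. *)
Lemma sum_mass_blocks h P (tgt : T -> S) (theta : R) :
  trivIset P -> (forall x, 0 < \sum_s h x s) ->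
  \sum_f mass h f *
      \prod_(B in P) (1 - theta * [forall x in B, f x == tgt x]%:R) =
  (\prod_x \sum_s h x s) *
      \prod_(B in P) (1 - theta * \prod_(x in B) (h x (tgt x) / \sum_s h x s)).
Proof.
move=> tP H0; set H := fun x => \sum_s h x s.
set rho := fun x => h x (tgt x) / H x.
have expand (e : {set T} -> R) : \prod_(B in P) (1 - theta * e B) =
    \sum_(J : {set {set T}} | J \subset P) \prod_(B in J) (- theta * e B).
  rewrite big_mkcond /=.
  rewrite (eq_bigr (fun B => (if B \in P then - theta * e B else 0) + 1)); last first.
    by move=> B _; case: ifP => _; rewrite ?add0r // mulNr addrC.
  rewrite bigA_distr [RHS]big_mkcond /=; apply: eq_bigr => J _.
  rewrite -big_mkcond /=; case: ifPn => [/subsetP sJP|].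
    by apply: eq_bigr => B /sJP ->.
  case/subsetPn => B BJ /negPf BP.
  by rewrite (bigD1 B) //= BP mul0r.
rewrite expand.
transitivity (\sum_f \sum_(J : {set {set T}} | J \subset P) mass h f *
    \prod_(B in J) (- theta * [forall x in B, f x == tgt x]%:R)).
  by apply: eq_bigr => f _; rewrite expand mulr_sumr.
rewrite exchange_big /= mulr_sumr; apply: eq_bigr => J sJP.
have tJ : trivIset J by apply: trivIsetS sJP tP.
have split_e (e : T -> R) : \prod_(B in J) (- theta * \prod_(x in B) e x) =
    (- theta) ^+ #|J| * \prod_(x in cover J) e x.
  by rewrite big_split prodr_const /= big_trivIset.
rewrite split_e.
under eq_bigr => f _.
  have -> : \prod_(B in J) (- theta * [forall x in B, f x == tgt x]%:R) =
    (- theta) ^+ #|J| * \prod_(x in cover J) (f x == tgt x)%:R.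
    rewrite -split_e; apply: eq_bigr => B _; congr (_ * _).
    case: (boolP [forall x in B, f x == tgt x]) => [/forall_inP a|].
      by rewrite big1 // => x /a ->.
    by case/forall_inPn => x xB /negPf nx; rewrite (bigD1 x) //= nx mul0r.
  rewrite mulrCA [X in _ * (_ * X)]big_mkcond /= -big_split /=.
  over.
rewrite -mulr_sumr mulrCA; congr (_ * _).
rewrite -(bigA_distr_bigA (fun x s =>
  h x s * (if x \in cover J then (s == tgt x)%:R else 1))).
rewrite [X in _ = _ * X]big_mkcond -big_split /=.
apply: eq_bigr => x _; case: ifP => _.
  rewrite /rho mulrC divfK ?gt_eqF // (bigD1 (tgt x)) //= eqxx mulr1.
  by rewrite big1 ?addr0 // => s /negPf ->; rewrite mulr0.
by rewrite mulr1; under eq_bigr do rewrite mulr1.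
Qed.

(** Squaring repeatedly with rounded decimals keeps the numbers small. *)
Lemma pow64_bound : (31%:R / 32%:R : R) ^+ 64 <= (1 / 2) * (1 / 2).
Proof.
have sq (y a b : R) : 0 <= y -> y <= a -> a * a <= b -> y * y <= b.
  by move=> y0 ya; apply: le_trans; apply: ler_pM.
set x : R := 31%:R / 32%:R.
have dbl n : x ^+ (n + n) = x ^+ n * x ^+ n by rewrite exprD.
have x0 n : 0 <= x ^+ n by apply: exprn_ge0; rewrite /x; lra.
have x2 : x ^+ 2 <= 94%:R / 100%:R by rewrite expr2 /x; lra.
have x4 : x ^+ 4 <= 89%:R / 100%:R by rewrite (dbl 2%N); apply: sq x2 _ => //; lra.
have x8 : x ^+ 8 <= 80%:R / 100%:R by rewrite (dbl 4%N); apply: sq x4 _ => //; lra.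
have x16 : x ^+ 16 <= 65%:R / 100%:R by rewrite (dbl 8%N); apply: sq x8 _ => //; lra.
have x32 : x ^+ 32 <= 1 / 2 by rewrite (dbl 16%N); apply: sq x16 _ => //; lra.
by rewrite (dbl 32%N); apply: ler_pM.
Qed.

(** Chernoff bound: compare the indicator of the event with the moment generating
    function of the number of blocks on which [f] agrees with [tgt]. *)
Lemma few_blocks_mass h P (tgt : T -> S) (alpha : nat) :
  trivIset P -> (forall x s, 0 <= h x s) -> (forall x, 0 < \sum_s h x s) ->
  (forall B, B \in P -> 1 / 16%:R <= \prod_(x in B) (h x (tgt x) / \sum_s h x s)) ->
  (64 * alpha <= #|P|)%N ->
  \sum_(f : {ffun T -> S} | (#|[set B in P | [forall x in B, f x == tgt x]]| < alpha)%N) mass h f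
  <= (1 / 2) ^+ alpha * \prod_x \sum_s h x s.
Proof.
move=> tP h0 H0 rho_ge cP.
set X := fun f : {ffun T -> S} => #|[set B in P | [forall x in B, f x == tgt x]]|.
have H_ge0 : 0 <= \prod_x \sum_s h x s by apply: prodr_ge0 => x _; apply: ltW.
have key : (1 / 2) ^+ alpha * \sum_(f | (X f < alpha)%N) mass h f <=
   (\prod_x \sum_s h x s) * (31%:R / 32%:R) ^+ (64 * alpha)%N.
  apply: (@le_trans _ _ (\sum_f mass h f *
      \prod_(B in P) (1 - (1 / 2) * [forall x in B, f x == tgt x]%:R))).
    rewrite mulr_sumr [X in X <= _]big_mkcond /=; apply: ler_sum => f _.
    have -> : \prod_(B in P) (1 - (1 / 2) * [forall x in B, f x == tgt x]%:R) =
              (1 / 2 : R) ^+ X f.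
      rewrite -prodr_const [LHS]big_mkcond [RHS]big_mkcond /=.
      apply: eq_bigr => B _; rewrite inE; case: (B \in P) => //=.
      by case: ifP => _; rewrite ?mulr1 ?mulr0 ?subr0 //; lra.
    case: ifPn => [lt|_].
      rewrite mulrC ler_wpM2l ?mass_ge0 //.
      by apply: ler_wiXn2l; [lra|lra|apply: ltnW].
    by rewrite mulr_ge0 ?mass_ge0 // exprn_ge0 //; lra.
  rewrite sum_mass_blocks // ler_wpM2l //.
  apply: (@le_trans _ _ (\prod_(B in P) (31%:R / 32%:R))).
    apply: ler_prod => B BP; have := rho_ge B BP.
    set r := \prod_(x in B) _ => ger.
    suff : r <= 1 by move=> ler; apply/andP; split; lra.
    apply: prodr_ile1 => x _.
    have Hx := H0 x; apply/andP; split; first by apply: divr_ge0 => //; apply: ltW.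
    rewrite ler_pdivrMr // mul1r.
    by rewrite (bigD1 (tgt x)) //= lerDl sumr_ge0.
  by rewrite prodr_const; apply: ler_wiXn2l => //; lra.
have p2 : 0 < (1 / 2 : R) ^+ alpha by apply: exprn_gt0; lra.
rewrite -(ler_pM2l p2); apply: (le_trans key).
rewrite exprM mulrA mulrC ler_wpM2r // -exprMn.
apply: lerXn2r; rewrite ?nnegrE ?pow64_bound //.
  by apply: exprn_ge0; lra.
by lra.
Qed.
End Mass.

(** * Random partial colourings and Russo's formula *)

(** A partial 2-colouring of the vertices; [None] means uncoloured. *)
Notation state T := {ffun T -> option bool}.

Definition recolour (T : finType) (f : state T) (v : T) (o : option bool) : state T :=
  [ffun x => if x == v then o else f x].

(** Both colours have probability [p], so [p] ranges over [[0, 1/2]]. *)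
Definition weight (R : realFieldType) (p : R) (o : option bool) : R :=
  (if o is Some _ then p else 1 - 2 * p)%R.

Definition mu (R : realFieldType) (T : finType) (p : R) (f : state T) : R :=
  mass (fun _ => weight p) f.

Section Russo.
Local Open Scope ring_scope.
Variables (R : realFieldType) (T : finType).
Implicit Types (f : state T) (p : R).

Lemma sum_option (A : option bool -> R) :
  \sum_o A o = A None + \sum_(c : bool) A (Some c).
Proof.
rewrite big_bool /= (bigD1 None) //= (bigD1 (Some true)) //= (bigD1 (Some false)) //=.
by rewrite big1 ?addr0 // => -[[]|].
Qed.

Lemma sum_weight p : \sum_o weight p o = 1.
Proof. by rewrite sum_option big_bool /=; ring. Qed.

Lemma sum_mu p : \sum_(f : state T) mu p f = 1.
Proof. by rewrite /mu (sum_mass (fun _ : T => weight p)) big1 // => x _; rewrite sum_weight. Qed.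

Lemma mu_ge0 p f : 0 <= p <= 1 / 2 -> 0 <= mu p f.
Proof. by case/andP=> p0 p1; apply: mass_ge0 => x [b|] /=; lra. Qed.

Lemma recolour_recolour f v o o' : recolour (recolour f v o) v o' = recolour f v o'.
Proof. by apply/ffunP => x; rewrite !ffunE; case: eqP. Qed.

Lemma recolour_id f v : recolour f v (f v) = f.
Proof. by apply/ffunP => x; rewrite !ffunE; case: eqP => [->|]. Qed.

Lemma recolour_at f v o : recolour f v o v = o.
Proof. by rewrite ffunE eqxx. Qed.

Lemma sum_by_update v (A : state T -> R) :
  \sum_(f : state T) A f = \sum_(f : state T | f v == None) \sum_o A (recolour f v o).
Proof.
rewrite (partition_big (fun f => recolour f v None) (fun f => f v == None)) /=; last first.
  by move=> f _; rewrite recolour_at.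
apply: eq_bigr => f /eqP fv.
rewrite (reindex_onto (fun o => recolour f v o) (fun g => g v)) /=; last first.
  by move=> g /eqP <-; rewrite recolour_recolour recolour_id.
apply: eq_bigl => o; rewrite recolour_recolour recolour_at eqxx andbT.
by rewrite -[X in _ == X](recolour_id f v) fv eqxx.
Qed.

(** The derivative of [weight] in [p]. *)
Definition dweight (o : option bool) : R := if o is Some _ then 1 else - 2.

Lemma deriv_prod (I : finType) (F : I -> {poly R}) :
  (\prod_i F i)^`() = \sum_i (F i)^`() * \prod_(j | j != i) F j.
Proof.
suff seq_version (r : seq I) : uniq r ->
    (\prod_(i <- r) F i)^`() = \sum_(i <- r) (F i)^`() * \prod_(j <- r | j != i) F j.
  by apply: seq_version; apply: index_enum_uniq.
elim: r => [_|a r IH /= /andP[ar ur]]; first by rewrite !big_nil derivE.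
rewrite !big_cons derivM IH //= eqxx /=; congr (_ * _ + _).
  rewrite big_seq [RHS]big_seq_cond; apply: eq_bigl => j; rewrite andbC.
  by case: eqP => //= ->; rewrite (negPf ar).
rewrite mulr_sumr big_seq [RHS]big_seq; apply: eq_bigr => i ir.
rewrite big_cons; case: eqP => [ai|_]; first by rewrite ai ir in ar.
by rewrite mulrCA.
Qed.

(** Russo's formula. The expectation is a polynomial in [p]; differentiating it
    changes the weight of one vertex [v] at a time, and grouping the states that
    differ only at [v] leaves the effect of colouring [v]. Working with a
    polynomial makes the mean value theorem available over any real closed
    field. *)
Lemma russo (Phi : state T -> R) :
  exists2 P : {poly R}, (forall p, P.[p] = \sum_(f : state T) mu p f * Phi f) &
    forall p, (1 - 2 * p) * P^`().[p] =
      \sum_(f : state T) mu p f *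
        \sum_(v | f v == None) \sum_(c : bool) (Phi (recolour f v (Some c)) - Phi f).
Proof.
pose W (o : option bool) : {poly R} := if o is Some _ then 'X else 1 - 2%:P * 'X.
have Wp p o : (W o).[p] = weight p o by case: o => [b|] /=; rewrite !hornerE.
have Wd p o : ((W o)^`()).[p] = dweight o.
  by case: o => [b|] /=; rewrite !derivE !hornerE //; ring.
exists (\sum_(f : state T) Phi f *: \prod_x W (f x)).
  move=> p; rewrite horner_sum; apply: eq_bigr => f _.
  by rewrite hornerZ horner_prod mulrC; congr (_ * _); apply: eq_bigr => x _; rewrite Wp.
move=> p; rewrite raddf_sum horner_sum /=.
transitivity (\sum_v \sum_(f : state T) (1 - 2 * p) * Phi f * dweight (f v) * \prod_(x | x != v) weight p (f x)).
  rewrite exchange_big /= mulr_sumr; apply: eq_bigr => f _.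
  rewrite derivZ hornerZ deriv_prod horner_sum !mulr_sumr; apply: eq_bigr => v _.
  rewrite hornerM Wd horner_prod !mulrA; congr (_ * _).
  by apply: eq_bigr => x _; rewrite Wp.
under [RHS]eq_bigr do rewrite big_mkcond mulr_sumr /=.
rewrite [RHS]exchange_big /=; apply: eq_bigr => v _.
rewrite (sum_by_update v) [RHS](bigID (fun f : state T => f v == None)) /=.
rewrite [X in _ = _ + X]big1 ?addr0; last by move=> f /negPf ->; rewrite mulr0.
apply: eq_bigr => f /eqP fv; rewrite fv eqxx.
have muE : mu p f = (1 - 2 * p) * \prod_(x | x != v) weight p (f x).
  by rewrite /mu /mass (bigD1 v) //= fv.
have prE o : \prod_(x | x != v) weight p (recolour f v o x) = \prod_(x | x != v) weight p (f x).
  by apply: eq_bigr => x /negPf xv; rewrite ffunE xv.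
have fN : recolour f v None = f by rewrite -fv recolour_id.
rewrite sum_option !big_bool /= !prE !recolour_at fN muE /=.
by ring.
Qed.
End Russo.

Section Decay.
Local Open Scope ring_scope.

(** Grönwall's inequality with a polynomial integrating factor: the product of
    [P] with [(1 + 'X) ^+ beta] has derivative at most a multiple of [eps], and the
    integrating factor grows by the factor [10/9] to the power [beta] between
    [1/8] and [1/4]. *)
Lemma poly_decay (R : rcfType) (P : {poly R}) (beta : nat) (eps : R) :
  0 <= eps -> (forall p, 1 / 8%:R <= p <= 1 / 4%:R -> 0 <= P.[p]) ->
  (forall p, 1 / 8%:R <= p <= 1 / 4%:R ->
     (1 - 2 * p) * P^`().[p] <= - beta%:R * P.[p] + eps) ->
  P.[1 / 4%:R] <= (9%:R / 10%:R) ^+ beta * P.[1 / 8%:R] + eps.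
Proof.
move=> eps0 P0 dP.
pose E : {poly R} := (1 + 'X) ^+ beta.
have Ep p : E.[p] = (1 + p) ^+ beta by rewrite /E horner_exp !hornerE.
have lt84 : 1 / 8%:R < 1 / 4%:R :> R by lra.
have [c cI] := poly_mvt (P * E) lt84.
have /andP[c0 c1] : (1 / 8%:R <= c <= 1 / 4%:R).
  by move: cI; rewrite inE /= => /andP[a b]; rewrite !ltW.
have cb : 1 / 8%:R <= c <= 1 / 4%:R by rewrite c0.
set D := (P * E)^`().[c].
have E0 : 0 <= E.[c] by rewrite Ep exprn_ge0 //; lra.
have Ele : E.[c] <= E.[1 / 4%:R].
  by rewrite !Ep; apply: lerXn2r; rewrite ?nnegrE; lra.
have DE : (1 - 2 * c) * D <= E.[c] * eps.
  rewrite /D derivM hornerD !hornerM mulrDr mulrA.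
  have -> : E^`().[c] = beta%:R * (1 + c) ^+ beta.-1.
    rewrite /E deriv_exp !derivE add0r mul1r hornerMn horner_exp !hornerE.
    by rewrite -mulr_natl.
  set a := beta%:R * (1 + c) ^+ beta.-1.
  have a0 : 0 <= a by rewrite mulr_ge0 ?ler0n ?exprn_ge0 //; lra.
  have aE : (1 - 2 * c) * a <= beta%:R * E.[c].
    rewrite Ep /a; case: (beta) => [|b] /=; first by rewrite !mul0r mulr0.
    rewrite mulrCA ler_wpM2l ?ler0n // exprS ler_wpM2r ?exprn_ge0 //; lra.
  have h1 : (1 - 2 * c) * P^`().[c] * E.[c] <= (- beta%:R * P.[c] + eps) * E.[c].
    by rewrite ler_wpM2r // dP.
  have h2 : P.[c] * ((1 - 2 * c) * a) <= P.[c] * (beta%:R * E.[c]).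
    by rewrite ler_wpM2l // P0.
  have -> : (1 - 2 * c) * P^`().[c] * E.[c] + (1 - 2 * c) * (P.[c] * a) =
    (1 - 2 * c) * P^`().[c] * E.[c] + P.[c] * ((1 - 2 * c) * a) by ring.
  apply: (le_trans (lerD h1 h2)); rewrite le_eqVlt; apply/orP; left; apply/eqP; ring.
have Dle : D <= 2 * (E.[1 / 4%:R] * eps).
  have D2 : D <= 2 * (E.[c] * eps).
    case: (leP D 0) => [D0|D0]; first by apply: (le_trans D0); rewrite !mulr_ge0.
    by apply: le_trans (_ : 2 * ((1 - 2 * c) * D) <= _); [nra|lra].
  by apply: (le_trans D2); rewrite ler_wpM2l // ler_wpM2r.
have E4 : 0 < E.[1 / 4%:R] by rewrite Ep exprn_gt0 //; lra.
rewrite !hornerM => eqD.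
have E8 : E.[1 / 8%:R] = (9%:R / 10%:R) ^+ beta * E.[1 / 4%:R].
  by rewrite !Ep -exprMn; congr (_ ^+ _); field.
rewrite -(ler_pM2r E4) mulrDl.
have -> : (9%:R / 10%:R) ^+ beta * P.[1 / 8%:R] * E.[1 / 4%:R] = P.[1 / 8%:R] * E.[1 / 8%:R].
  by rewrite E8; ring.
have e0 : 0 <= eps * E.[1 / 4%:R] by rewrite mulr_ge0 // ltW.
by nra.
Qed.
End Decay.

(** * Components of a partial colouring and merging vertices *)

Section Components.
Variables (T : finType) (G : sgraph T).
Implicit Types (f : state T) (C : {set T}).

Definition opposite (o o' : option bool) : bool :=
  if (o, o') is (Some b, Some b') then b != b' else false.

Lemma oppositeC o o' : opposite o o' = opposite o' o.
Proof. by case: o o' => [[]|] [[]|]. Qed.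

Definition sampled_edge f : rel T := [rel x y | G x y && opposite (f x) (f y)].

Lemma sampled_edgeE f x y : sampled_edge f x y = G x y && opposite (f x) (f y).
Proof. by []. Qed.

Lemma sampled_edge_sym f : symmetric (sampled_edge f).
Proof. by move=> x y; rewrite !sampled_edgeE adj_sym oppositeC. Qed.

Lemma sampled_connect_sym f : connect_sym (sampled_edge f).
Proof. by apply: sym_connect_sym; apply: sampled_edge_sym. Qed.

Definition component f x : {set T} := [set y | connect (sampled_edge f) x y].

Definition components f : {set {set T}} := [set component f x | x in [set x | f x != None]].

(** The components that become connected to the uncoloured vertex [v] when [v]
    receives the colour [c]. *)
Definition joined f v c : {set {set T}} :=
  [set C in components f | [exists y in C, G v y && (f y == Some (~~ c))]].

(** The ways to glue [C] to another component by colouring a single vertex. *)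
Definition merging f C : {set T * bool} :=
  [set vc | [&& f vc.1 == None, C \in joined f vc.1 vc.2 & 1 < #|joined f vc.1 vc.2|]].

(** The vertices about which exploring [C] reveals nothing. *)
Definition far C : {set T} := [set v | (v \notin C) && [forall y in C, ~~ G y v]].

Lemma in_component f x y : (y \in component f x) = connect (sampled_edge f) x y.
Proof. by rewrite inE. Qed.

Lemma in_joined f v c C : (C \in joined f v c) =
  (C \in components f) && [exists y in C, G v y && (f y == Some (~~ c))].
Proof. by rewrite inE. Qed.

Lemma in_merging f C v c : ((v, c) \in merging f C) =
  [&& f v == None, C \in joined f v c & 1 < #|joined f v c|].
Proof. by rewrite inE. Qed.

Lemma in_far C v : (v \in far C) = (v \notin C) && [forall y in C, ~~ G y v].
Proof. by rewrite inE. Qed.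

Lemma component_refl f x : x \in component f x.
Proof. by rewrite in_component. Qed.

Lemma component_eq f x y : connect (sampled_edge f) x y -> component f x = component f y.
Proof. by move=> cxy; apply/setP => z; rewrite !in_component (same_connect (@sampled_connect_sym f) cxy). Qed.

Lemma mem_component f x y : y \in component f x -> component f y = component f x.
Proof. by rewrite in_component => /component_eq ->. Qed.

Lemma connect_invariant (e : rel T) (A : {pred T}) x y :
  (forall a b, a \in A -> e a b -> b \in A) -> x \in A -> connect e x y -> y \in A.
Proof.
move=> clo xA /connectP[p pth ->]; elim: p x xA pth => //= a p IH x xA /andP[xa pth].
by apply: IH pth; apply: clo xa.
Qed.

Lemma component_coloured f x y : f x != None -> y \in component f x -> f y != None.
Proof.
move=> fx; rewrite in_component => cxy.
have: y \in [pred z | f z != None]; last by [].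
apply: connect_invariant cxy => // a b _; rewrite sampled_edgeE => /andP[_] /=.
by rewrite !inE; case: (f a) (f b) => [[]|] [[]|].
Qed.

Lemma components_coloured f C y : C \in components f -> y \in C -> f y != None.
Proof. by case/imsetP => x; rewrite inE => fx -> yC; apply: component_coloured fx yC. Qed.

Lemma mem_components f x : f x != None -> component f x \in components f.
Proof. by move=> fx; apply/imsetP; exists x => //; rewrite inE. Qed.

(** Every new component either contains [v] or is an old component that [v] does
    not join. *)
Lemma card_components_recolour f v c : f v = None ->
  #|components (recolour f v (Some c))| + #|joined f v c| <= #|components f| + 1.
Proof.
move=> fv; set f' := recolour f v (Some c).
have sub x y : sampled_edge f x y -> sampled_edge f' x y.
  rewrite !sampled_edgeE => /andP[-> /=]; rewrite !ffunE.
  by do 2![case: eqP => [->|_]; rewrite ?fv //]; case: (f x).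
have csub x y : connect (sampled_edge f) x y -> connect (sampled_edge f') x y.
  by apply: connect_sub => a b /sub; apply: connect1.
(* The default [v] is irrelevant: components are not empty. *)
pose rep C := odflt v [pick x in C].
have cover : components f' \subset
    component f' v |: [set component f' (rep C) | C in components f :\: joined f v c].
  apply/subsetP => D /imsetP[x]; rewrite inE => f'x ->{D}.
  case: (eqVneq x v) => [->|xv]; first by rewrite setU11.
  have fx : f x != None by move: f'x; rewrite ffunE (negPf xv).
  apply/setU1P; case: (boolP (component f x \in joined f v c)) => [j|nj]; [left|right].
    move: j; rewrite in_joined mem_components //= => /existsP[y /and3P[]]; rewrite in_component => cxy Gvy fy.
    apply: component_eq; rewrite sampled_connect_sym; apply: connect_trans (connect1 _) _; last first.
      by rewrite sampled_connect_sym; apply: csub cxy.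
    have /negPf yv : y != v by apply/eqP => e; rewrite e fv in fy.
    by rewrite sampled_edgeE Gvy !ffunE eqxx yv (eqP fy); case: (c).
  apply/imsetP; exists (component f x); first by rewrite inE nj mem_components.
  apply: component_eq; apply: csub; rewrite /rep.
  case: pickP => [y|/(_ x)]; first by rewrite in_component.
  by rewrite component_refl.
have jsub : joined f v c \subset components f by apply/subsetP => C; rewrite in_joined => /andP[].
have le1 : #|components f'| <= 1 + #|components f :\: joined f v c|.
  apply: leq_trans (subset_leq_card cover) (leq_trans (leq_card_setU _ _) _).
  by rewrite cards1 leq_add2l leq_imset_card.
move: le1 (subset_leq_card jsub); rewrite cardsD (setIidPr jsub); lia.
Qed.

(** In such a state, colouring a vertex never creates a component; for a full
    colouring, the condition keeps the components large when few vertices are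
    deleted. *)
Definition degree_ok alpha f :=
  [forall v, forall c, alpha <= #|[set y | G v y & f y == Some c]|].

(** Whether the component of [x] has enough merging vertices, when enough vertices
    are far from it for the exploration argument to apply. *)
Definition escape_ok alpha f x :=
  (f x != None) && (128 * alpha <= #|far (component f x)|) ==>
  (alpha <= #|merging f (component f x)|).

(** The last condition leaves [2 * alpha] uncoloured vertices after discarding those
    far from one of three components with fewer than [128 * alpha] far vertices
    each: [386 = 3 * 128 + 2]. *)
Definition good alpha f :=
  [&& degree_ok alpha f, [forall x, escape_ok alpha f x]
    & 386 * alpha <= #|[set x | f x == None]|].

(** Two components are allowed for: they can be the two classes of a bipartite [G]
    that agree and disagree with the colouring. *)
Definition excess f := #|components f| - 2.

Lemma joined_gt0 alpha f v c : 0 < alpha -> degree_ok alpha f -> 0 < #|joined f v c|.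
Proof.
move=> a0 /forallP/(_ v)/forallP/(_ (~~ c)) /(leq_trans a0) /card_gt0P[y].
rewrite inE => /andP[Gvy /eqP fy]; apply/card_gt0P; exists (component f y).
rewrite in_joined mem_components ?fy //; apply/existsP; exists y.
by rewrite component_refl Gvy fy eqxx.
Qed.

(** Double counting of the pairs of a component and a way to merge it. *)
Lemma card_merging f :
  \sum_(v | f v == None) \sum_(c : bool) #|joined f v c| * (1 < #|joined f v c|) =
  \sum_(C in components f) #|merging f C|.
Proof.
rewrite pair_big_dep /=.
under [RHS]eq_bigr do rewrite -sum1_card big_mkcond /=.
rewrite exchange_big /= [LHS]big_mkcond /=; apply: eq_bigr => -[v c] _ /=.
under [RHS]eq_bigr do rewrite in_merging /=.
case: (f v == None) => /=; last by rewrite big1.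
case: (1 < _); last by rewrite muln0 big1 // => C _; rewrite andbF.
rewrite muln1 -sum1_card big_mkcond [RHS]big_mkcond /=; apply: eq_bigr => C _.
by rewrite andbT in_joined; case: (C \in components f).
Qed.

(** Three components with few merging vertices also have few far vertices, so
    many uncoloured vertices are adjacent to all of them. By the pigeonhole
    principle such a vertex sees the same colour in two of the three components,
    and colouring it with the other colour merges these two. One of the two is
    the first or the second component, so one of these has many merging vertices. *)
Lemma card_stuck alpha f : 0 < alpha -> good alpha f ->
  #|[set C in components f | #|merging f C| < alpha]| <= 2.
Proof.
move=> a0 /and3P[_ /forallP esc mD]; rewrite leqNgt; apply/card_gt2P.
case=> C1 [C2 [C3 [[]]]]; rewrite !inE.
move=> /andP[c1 m1] /andP[c2 m2] /andP[c3 m3] [n12 n23 n31].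
have near C : C \in components f -> #|merging f C| < alpha -> #|far C| < 128 * alpha.
  case/imsetP => x; rewrite inE => fx -> m.
  by have := esc x; rewrite /escape_ok fx /= leqNgt [alpha <= _]leqNgt m /= implybF negbK.
have r1 := near _ c1 m1; have r2 := near _ c2 m2; have r3 := near _ c3 m3.
set U := [set x | f x == None] :\: (far C1 :|: far C2 :|: far C3).
have cU : 2 * alpha <= #|U|.
  have := cardsD [set x | f x == None] (far C1 :|: far C2 :|: far C3).
  rewrite -/U => cD.
  have := subset_leq_card (subsetIr [set x | f x == None] (far C1 :|: far C2 :|: far C3)).
  have := (leq_card_setU (far C1 :|: far C2) (far C3)).1.
  have := (leq_card_setU (far C1) (far C2)).1.
  lia.
have sub : U \subset fst @: merging f C1 :|: fst @: merging f C2.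
  apply/subsetP => u; rewrite !(in_setU, in_setD, in_far) !negb_or !inE => /andP[/andP[/andP[u1 u2] u3] /eqP fu].
  (* The colour that [u] must take to join a component adjacent to it. *)
  have touch C : C \in components f -> ~~ ((u \notin C) && [forall y in C, ~~ G y u]) ->
      exists2 b, C \in joined f u b & True.
    move=> cC; rewrite negb_and negbK.
    case: (boolP (u \in C)) => [uC|_ /=]; first by have := components_coloured cC uC; rewrite fu.
    case/forall_inPn => y yC; rewrite negbK => Gyu.
    have := components_coloured cC yC; case fy: (f y) => [b|//] _.
    exists (~~ b) => //; rewrite in_joined cC; apply/existsP; exists y.
    by rewrite yC adj_sym Gyu fy negbK eqxx.
  have pairm b Ca Cb : Ca != Cb -> Ca \in joined f u b -> Cb \in joined f u b ->
      (u, b) \in merging f Ca.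
    move=> nab ja jb; rewrite in_merging fu ja /=; apply/card_gt1P; exists Ca, Cb; split=> //.
  have [b1 j1 _] := touch _ c1 u1; have [b2 j2 _] := touch _ c2 u2.
  have [b3 j3 _] := touch _ c3 u3.
  have [e|ne12] := eqVneq b1 b2.
    apply/orP; left; apply/imsetP; exists (u, b1) => //; apply: pairm n12 j1 _.
    by rewrite e.
  have [e|ne13] := eqVneq b1 b3.
    apply/orP; left; apply/imsetP; exists (u, b1) => //; apply: (pairm _ _ C3) j1 _.
      by rewrite eq_sym.
    by rewrite e.
  have e : b2 = b3 by case: b1 b2 b3 ne12 ne13 {j1 j2 j3} => [] [] [].
  apply/orP; right; apply/imsetP; exists (u, b2) => //; apply: (pairm _ _ C3) j2 _ => //.
  by rewrite e.
have := subset_leq_card sub.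
have := (leq_card_setU (fst @: merging f C1) (fst @: merging f C2)).1.
have l1 : #|fst @: merging f C1| <= #|merging f C1| by apply: leq_imset_card.
have l2 : #|fst @: merging f C2| <= #|merging f C2| by apply: leq_imset_card.
lia.
Qed.

(** Merging [r >= 2] of [m >= 3] components lowers the excess by at least
    [min (r - 1) (m - 2)], which is at least [r / 3]. *)
Lemma excess_recolour alpha f v c : 0 < alpha -> degree_ok alpha f -> f v = None ->
  2 < #|components f| ->
  3 * excess (recolour f v (Some c)) + #|joined f v c| * (1 < #|joined f v c|) <= 3 * excess f.
Proof.
move=> a0 dok fv m2; have := card_components_recolour c fv; have := joined_gt0 v c a0 dok.
have : #|joined f v c| <= #|components f|.
  by apply: subset_leq_card; apply/subsetP => C; rewrite in_joined => /andP[].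
by rewrite /excess; case: (ltnP 1) => h; lia.
Qed.

(** In a good state, the average effect of colouring one more vertex is a loss
    proportional to the excess: all but two components have at least [alpha]
    merging vertices. *)
Lemma excess_drop alpha f : 0 < alpha -> good alpha f ->
  3 * (\sum_(v | f v == None) \sum_(c : bool) excess (recolour f v (Some c)))
    + alpha * excess f <=
  3 * (\sum_(v | f v == None) \sum_(c : bool) excess f).
Proof.
move=> a0 gf; have /and3P[dok _ _] := gf.
case: (leqP #|components f| 2) => [le2|gt2].
  have e0 : excess f = 0 by apply/eqP; rewrite subn_eq0.
  rewrite e0 muln0 addn0 leq_mul2l /=; apply: leq_sum => v /eqP fv.
  apply: leq_sum => c _; have := card_components_recolour c fv; have := joined_gt0 v c a0 dok.
  by rewrite /excess; lia.
have stuck := card_stuck a0 gf.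
have tot : alpha * excess f <= \sum_(C in components f) #|merging f C|.
  rewrite (bigID (fun C => #|merging f C| < alpha)) /=.
  apply: leq_trans (leq_addl _ _).
  apply: (@leq_trans (\sum_(C in [set C in components f | ~~ (#|merging f C| < alpha)]) alpha)).
    rewrite sum_nat_const mulnC leq_mul2r; apply/orP; right.
    have := cardsID [set C | #|merging f C| < alpha] (components f).
    rewrite /excess.
    have -> : components f :&: [set C | #|merging f C| < alpha] =
      [set C in components f | #|merging f C| < alpha] by apply/setP => C; rewrite !inE.
    have -> : components f :\: [set C | #|merging f C| < alpha] =
      [set C in components f | ~~ (#|merging f C| < alpha)].
      by apply/setP => C; rewrite !inE andbC.
    by move=> <-; rewrite leq_subLR leq_add2r; exact: stuck.
  rewrite big_mkcond [leqRHS]big_mkcond /=; apply: leq_sum => C _.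
  by rewrite inE; case: ifP => // /andP[_]; rewrite -leqNgt.
rewrite -card_merging in tot; apply: leq_trans (leq_add (leqnn _) tot) _.
rewrite !big_distrr -big_split /=; apply: leq_sum => v /eqP fv.
rewrite !big_distrr -big_split /=; apply: leq_sum => c _.
exact: excess_recolour a0 dok fv gt2.
Qed.
End Components.

(** * Exploring one component *)

Section Exploration.
Variables (T : finType) (G : sgraph T) (K : nat).
Hypothesis robustG : forall S : {set T}, #|S| <= K -> connected_without G S.
Implicit Types (f : state T) (C : {set T}).

Lemma card_cover_pairs (P : {set {set T}}) :
  (forall B, B \in P -> #|B| <= 2) -> #|cover P| <= 2 * #|P|.
Proof.
move=> P2; apply: leq_trans (leq_card_cover P).1 _.
by rewrite mulnC -sum_nat_const; apply: leq_sum => B /P2.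
Qed.

(** The matched vertices of a maximal matching between the neighbours of [C] and
    the vertices far from [C] separate [C] from every unmatched far vertex, so
    there cannot be few of them. This costs a factor two against Menger's
    theorem and avoids it. *)
Lemma far_matching C m : C != set0 -> 2 * m <= #|far G C| -> 2 * m <= K ->
  exists P : {set {set T}}, [/\ trivIset P, m <= #|P| &
    forall B, B \in P -> exists u v,
      [/\ B = [set u; v], u \notin C, u \notin far G C, v \in far G C & G u v]].
Proof.
move=> C0 mfar mK.
pose edge B := [exists u, exists v, [&& B == [set u; v], u \notin C, u \notin far G C,
   v \in far G C & G u v]].
have edgeP B : edge B -> exists u v,
    [/\ B = [set u; v], u \notin C, u \notin far G C, v \in far G C & G u v].
  by case/existsP => u /existsP[v /and5P[/eqP]]; exists u, v.
pose matching (P : {set {set T}}) := trivIset P && [forall B in P, edge B].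
have m0 : matching set0.
  rewrite /matching; apply/andP; split; last by apply/forall_inP => B; rewrite inE.
  by apply/trivIsetP => B B'; rewrite inE.
have [P /maxsetP[/andP[tP /forall_inP eP] maxP] _] := maxset_exists m0.
exists P; split=> //; last by move=> B /eP /edgeP.
rewrite leqNgt; apply/negP => ltm.
have cS : #|cover P| <= 2 * #|P|.
  apply: card_cover_pairs => B /eP /edgeP[u [v [-> _ _ _ _]]].
  by rewrite cards2; case: eqP.
have /subsetPn[r rfar rS] : ~~ (far G C \subset cover P).
  by apply/negP => /subset_leq_card; lia.
have CS y : y \in C -> y \notin cover P.
  move=> yC; apply/bigcupP => -[B /eP /edgeP[u [v [-> uC _ vf _]]]].
  rewrite !inE => /orP[] /eqP e; first by rewrite -e yC in uC.
  by move: vf; rewrite in_far -e yC.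
case/set0Pn: C0 => c cC.
have conn : connect (del_vertices G (cover P)) c r.
  by apply: robustG => //; [lia|apply: CS].
have : r \in [pred z | z \notin far G C]; last by rewrite inE rfar.
apply: connect_invariant conn; last by rewrite inE in_far cC.
move=> a b af /and3P[aS bS Gab].
change (is_true (a \notin far G C)) in af; change (is_true (b \notin far G C)).
apply/negP => bf.
have aC : a \notin C.
  apply/negP => aC; move: bf; rewrite in_far => /andP[_ /forall_inP/(_ a aC)].
  by rewrite Gab.
(* An edge from a neighbour of [C] to a far vertex would extend the matching. *)
have eab : edge [set a; b].
  by apply/existsP; exists a; apply/existsP; exists b; rewrite eqxx aC af bf Gab.
have dis : [disjoint [set a; b] & cover P].
  rewrite disjoint_subset; apply/subsetP => z; rewrite !inE.
  by case/orP => /eqP ->.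
have notin : [set a; b] \notin P.
  apply: contra aS => abP; apply/bigcupP; exists [set a; b] => //.
  by rewrite !inE eqxx.
have : [set a; b] |: P = P.
  apply: maxP; last by apply: subsetUr.
  rewrite /matching; apply/andP; split.
    apply/trivIsetP => X Y /setU1P[->|XP] /setU1P[->|YP]; rewrite ?eqxx // => nXY.
    - by apply: disjointWr dis; apply: bigcup_sup.
    - by rewrite disjoint_sym; apply: disjointWr dis; apply: bigcup_sup.
    - by move/trivIsetP: tP; apply.
  by apply/forall_inP => X /setU1P[->//|/eP].
by move/setP/(_ [set a; b]); rewrite setU11 (negPf notin).
Qed.

Section Explore.
Variables (x : T) (f0 : state T).
Hypothesis f0x : f0 x != None.

(** Everything that is learnt by exploring the component of [x]: its vertex set
    and the colours on it. *)
Definition explored f : {set T} * state T :=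
  (component G f x, [ffun v => if v \in component G f x then f v else None]).

Let C := component G f0 x.

Definition allowed v o :=
  if v \in C then o == f0 v else [forall y in C, G y v ==> ~~ opposite (f0 y) o].

Lemma exploredE f : explored f = explored f0 ->
  component G f x = C /\ forall v, v \in C -> f v = f0 v.
Proof.
case=> e /ffunP e2; split=> // v vC; have := e2 v.
by rewrite !ffunE e vC.
Qed.

(** The states with a given exploration form a product set, because the
    exploration only says that no edge leaves the component. The distribution
    conditional on an exploration is therefore again a product. *)
Lemma explored_allowed f :
  (explored f == explored f0) = [forall v, allowed v (f v)].
Proof.
apply/eqP/forallP => [/exploredE[eC ef] v|all_ok].
  rewrite /allowed; case: ifPn => [vC|vC]; first by rewrite ef.
  apply/forall_inP => y yC; apply/implyP => Gyv; apply: contra vC => op.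
  rewrite -eC in_component; have := yC; rewrite -{1}eC in_component => cxy.
  by apply: connect_trans cxy (connect1 _); rewrite sampled_edgeE Gyv ef.
have ef v : v \in C -> f v = f0 v.
  by move=> vC; have := all_ok v; rewrite /allowed vC => /eqP.
have eC : component G f x = C.
  apply/setP => z; apply/idP/idP; rewrite in_component => cxz; last first.
    have {}cxz : connect (sampled_edge G f0) x z by rewrite -in_component.
    have : z \in [pred z | (z \in C) && connect (sampled_edge G f) x z]; last by case/andP.
    apply: connect_invariant cxz; last by rewrite inE component_refl connect0.
    move=> a b /andP[/= aC cxa] hab.
    have bC : b \in C.
      by rewrite in_component; apply: connect_trans _ (connect1 hab); rewrite -in_component.
    rewrite inE bC; apply: connect_trans cxa (connect1 _).
    by move: hab; rewrite !sampled_edgeE !ef.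
  apply: connect_invariant cxz; last exact: component_refl.
  move=> a b aC; rewrite sampled_edgeE => /andP[Gab op]; apply/negPn/negP => bC.
  have := all_ok b; rewrite /allowed (negPf bC) => /forall_inP/(_ a aC).
  by rewrite Gab -(ef a) ?op.
rewrite /explored eC; congr (_, _); apply/ffunP => v; rewrite !ffunE.
by case: ifP => // /ef ->.
Qed.

Definition touching_colour u : option bool := f0 (odflt x [pick y in C | G y u]).

(** For a block made of a neighbour [u] of [C] and a far vertex [v], [u] should be
    uncoloured, and [v] should have the colour of a neighbour of [u] in [C]:
    then colouring [u] with the other colour merges [C] with the component of
    [v]. *)
Definition target (P : {set {set T}}) (v : T) : option bool :=
  if v \in far G C then touching_colour (odflt v [pick u in pblock P v :\ v]) else None.

Lemma touching_colourP u : u \notin C -> u \notin far G C ->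
  exists y c, [/\ y \in C, G y u, f0 y = Some c & touching_colour u = Some c].
Proof.
move=> uC; rewrite in_far uC /= => /forall_inPn[z zC]; rewrite negbK => Gzu.
rewrite /touching_colour; case: pickP => [y|/(_ z)]; last by rewrite zC Gzu.
case/andP => yC Gyu /=; have := component_coloured f0x yC.
by case fy: (f0 y) => [c|//] _; exists y, c.
Qed.

Lemma merging_of_block f P u v : trivIset P -> [set u; v] \in P ->
  u \notin C -> u \notin far G C -> v \in far G C -> G u v ->
  explored f = explored f0 ->
  [forall w in [set u; v], f w == target P w] ->
  exists c, (u, c) \in merging G f C.
Proof.
move=> tP BP uC uf vf Guv /exploredE[eC ef] /forall_inP pass.
have uv : u != v by apply: contraNneq uf => ->.
have /eqP := pass u (set21 _ _); rewrite /target (negPf uf) => fu.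
have /eqP := pass v (set22 _ _); rewrite /target vf.
rewrite (def_pblock tP BP) ?set22 //.
have -> : [set u; v] :\ v = [set u].
  by apply/setP => z; rewrite !inE; case: eqP => [->|]; rewrite ?orbF // eq_sym (negPf uv).
case: pickP => [z|/(_ u)]; last by rewrite set11.
rewrite inE => /eqP -> /=.
have [y [c [yC Gyu fy ->]]] := touching_colourP uC uf => fv.
have CE : C \in components G f by rewrite -eC mem_components // ef ?f0x // /C component_refl.
have jC : C \in joined G f u (~~ c).
  rewrite in_joined CE; apply/existsP; exists y.
  by rewrite yC adj_sym Gyu ef // fy negbK eqxx.
have jv : component G f v \in joined G f u (~~ c).
  rewrite in_joined mem_components ?fv //; apply/existsP; exists v.
  by rewrite component_refl Guv fv negbK eqxx.
exists (~~ c); rewrite in_merging fu jC /=; apply/card_gt1P; exists C, (component G f v).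
split=> //; apply: contraTneq vf => e; rewrite in_far negb_and negbK e.
by rewrite component_refl.
Qed.
End Explore.
End Exploration.

(** * Bad partial colourings are rare *)

Section Rarity.
Local Open Scope ring_scope.
Variables (R : realFieldType) (p : R).
Hypothesis p_bounds : 1 / 8%:R <= p <= 1 / 4%:R.
Variables (T : finType) (G : sgraph T) (K : nat).
Hypothesis robustG : forall S : {set T}, (#|S| <= K)%N -> connected_without G S.
Hypothesis K_lt : (K < #|T|)%N.
Implicit Types (f : state T).

Let p8 : 1 / 8%:R <= p. Proof. by case/andP: p_bounds. Qed.
Let p4 : p <= 1 / 4%:R. Proof. by case/andP: p_bounds. Qed.

Lemma weight_ge o : 1 / 16%:R <= weight p o.
Proof. by move: p8 p4; case: o => [b|] /=; lra. Qed.

Lemma weight_gt0 o : 0 < weight p o.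
Proof. by apply: lt_le_trans (weight_ge o); lra. Qed.

Lemma mu_range_ge0 f : 0 <= mu p f.
Proof. by apply: mu_ge0; move: p8 p4 => *; apply/andP; split; lra. Qed.

(** The Chernoff bound with singletons as blocks. *)
Lemma few_of_colour (A : {set T}) o alpha : (64 * alpha <= #|A|)%N ->
  \sum_(f : state T | (#|[set y in A | f y == o]| < alpha)%N) mu p f <= (1 / 2) ^+ alpha.
Proof.
move=> cA; pose P := [set [set y] | y in A].
have inj1 : injective (fun y : T => [set y]) by move=> a b /set1_inj.
have cP : #|P| = #|A| by rewrite card_imset.
have tP : trivIset P.
  apply/trivIsetP => _ _ /imsetP[a _ ->] /imsetP[b _ ->] ab.
  by rewrite disjoints1 inE; apply: contraNneq ab => ->.
have := @few_blocks_mass R T _ (fun _ => weight p) P (fun _ => o) alpha tP.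
have -> : \prod_(x : T) \sum_s weight p s = 1 by rewrite big1 // => x _; rewrite sum_weight.
rewrite mulr1 => few; apply: le_trans (few _ _ _ _) => //; last by rewrite cP.
- rewrite [leLHS]big_mkcond [leRHS]big_mkcond /=; apply: ler_sum => f _.
  have -> : #|[set B in P | [forall x in B, f x == o]]| = #|[set y in A | f y == o]|.
    rewrite -(card_imset _ inj1); apply: eq_card => B; rewrite !inE.
    apply/andP/imsetP => [[/imsetP[y yA ->] /forall_inP fy]|[y]].
      by exists y => //; rewrite inE yA fy ?set11.
    rewrite inE => /andP[yA fy] ->; rewrite imset_f //; split=> //.
    by apply/forall_inP => z; rewrite inE => /eqP ->.
  by rewrite lexx.
- by move=> x s; apply/ltW/weight_gt0.
- by move=> x; rewrite sum_weight.
- move=> _ /imsetP[y _ ->]; rewrite big_set1 sum_weight divr1; exact: weight_ge.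
Qed.

(** The neighbourhood of a vertex of smaller degree would be a small separator; it
    leaves another vertex because [K < #|T|]. *)
Lemma degree_ge v : (K <= #|[set y | G v y]|)%N.
Proof.
rewrite leqNgt; apply/negP => lt; set N := [set y | G v y] in lt.
have vN : v \notin N by rewrite inE adj_irrefl.
have /subsetPn[z _] : ~~ ([set: T] \subset v |: N).
  by apply/negP => /subset_leq_card; rewrite cardsU1 vN cardsT; move: K_lt; lia.
rewrite !inE negb_or => /andP[zv nGvz].
have : connect (del_vertices G N) v z.
  by apply: robustG; [apply: ltnW|rewrite inE adj_irrefl|rewrite inE].
move/(connect_invariant (A := pred1 v)); rewrite !inE eqxx (negPf zv) => clo.
apply/notF/clo => // a b /eqP -> /and3P[_ bN Gvb].
by rewrite inE Gvb in bN.
Qed.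

Lemma degree_fails alpha : (64 * alpha <= K)%N ->
  \sum_(f : state T | ~~ degree_ok G alpha f) mu p f <= (2 * #|T|)%:R * (1 / 2) ^+ alpha.
Proof.
move=> aK.
apply: (@le_trans _ _ (\sum_(vc : T * bool) \sum_(f : state T |
   (#|[set y in [set y | G vc.1 y] | f y == Some vc.2]| < alpha)%N) mu p f)).
  rewrite (exchange_big_dep xpredT) //= [leLHS]big_mkcond; apply: ler_sum => f _ /=.
  case: ifPn => [|_]; last by apply: sumr_ge0 => vc _; apply: mu_range_ge0.
  case/forallPn => v /forallPn[c]; rewrite -ltnNge => lt.
  rewrite (bigD1 (v, c)) /=; last first.
    by apply: leq_ltn_trans lt; apply: subset_leq_card; apply/subsetP => y; rewrite !inE.
  by rewrite lerDl; apply: sumr_ge0 => vc _; apply: mu_range_ge0.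
apply: (@le_trans _ _ (\sum_(vc : T * bool) (1 / 2) ^+ alpha)).
  apply: ler_sum => vc _; apply: few_of_colour.
  by apply: leq_trans aK (degree_ge _).
by rewrite sumr_const card_prod card_bool mulnC -[X in X <= _]mulr_natl.
Qed.

(** Conditionally on the exploration of [x], the edges of the matching are
    independent, and each provides a merging vertex with probability at least
    [1/2 * 1/8]. *)
Lemma cell_fails alpha x f0 : f0 x != None ->
  (128 * alpha <= #|far G (component G f0 x)|)%N -> (128 * alpha <= K)%N ->
  \sum_(f : state T | (explored G x f == explored G x f0) &&
     (#|merging G f (component G f0 x)| < alpha)%N) mu p f <=
  (1 / 2) ^+ alpha * \sum_(f : state T | explored G x f == explored G x f0) mu p f.
Proof.
move=> f0x mfar mK; set C := component G f0 x.
have C0 : C != set0 by apply/set0Pn; exists x; rewrite /C component_refl.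
have mf : (2 * (64 * alpha) <= #|far G C|)%N by rewrite mulnA.
have mk : (2 * (64 * alpha) <= K)%N by rewrite mulnA.
have [P [tP cP edgeP]] := far_matching robustG C0 mf mk.
(* The weights conditional on the exploration, up to normalisation. *)
pose h v o : R := weight p o * (allowed G x f0 v o)%:R.
have massE f : mass h f = if explored G x f == explored G x f0 then mu p f else 0.
  rewrite explored_allowed // /mass big_split /= -/(mass _ _) -/(mu p f).
  case: ifPn => [/forallP ok|/forallPn[v /negPf nv]].
    by rewrite [X in _ * X]big1 ?mulr1 // => v _; rewrite ok.
  by rewrite [X in _ * X](bigD1 v) //= nv mul0r mulr0.
have h0 v o : 0 <= h v o by rewrite mulr_ge0 ?ler0n // ltW // weight_gt0.
have Hle1 v : \sum_o h v o <= 1.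
  rewrite -(sum_weight p); apply: ler_sum => o _; rewrite ger_pMr ?weight_gt0 //.
  by rewrite lern1 leq_b1.
have hN v : v \notin C -> h v None = 1 - 2 * p.
  move=> vC; rewrite /h /allowed (negPf vC) /=.
  suff -> : [forall y in C, G y v ==> ~~ opposite (f0 y) None] by rewrite mulr1.
  by apply/forall_inP => y _; rewrite oppositeC implybT.
have H0 v : 0 < \sum_o h v o.
  case: (boolP (v \in C)) => vC.
    rewrite (bigD1 (f0 v)) //= ltr_wpDr ?sumr_ge0 //.
    by rewrite /h /allowed vC eqxx mulr1 weight_gt0.
  rewrite (bigD1 None) //= ltr_wpDr ?sumr_ge0 //.
  by rewrite hN //; move: p4; lra.
have blocks B : B \in P ->
    1 / 16%:R <= \prod_(v in B) (h v (target G x f0 P v) / \sum_o h v o).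
  move=> BP; have [u [v [eB uC uf vf Guv]]] := edgeP B BP.
  have uv : u != v by apply: contraNneq uf => ->.
  rewrite eB big_setU1 ?inE //= big_set1.
  have hdiv w o : h w o <= h w o / \sum_o h w o.
    by rewrite ler_pdivlMr // ler_piMr.
  have vC : v \notin C by move: vf; rewrite in_far => /andP[].
  have hu : 1 / 2 <= h u (target G x f0 P u).
    by rewrite /target (negPf uf) hN //; move: p4; lra.
  have hv : 1 / 8%:R <= h v (target G x f0 P v).
    rewrite /h /allowed (negPf vC).
    have -> : [forall y in C, G y v ==> ~~ opposite (f0 y) (target G x f0 P v)].
      apply/forall_inP => y yC; apply/implyP => Gyv.
      by move: vf; rewrite in_far => /andP[_ /forall_inP/(_ y yC)]; rewrite Gyv.
    by move: p8 p4; case: (target _ _ _ _ _) => [b|] /=; lra.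
  have -> : 1 / 16%:R = (1 / 2) * (1 / 8%:R) :> R by field.
  by apply: ler_pM; rewrite ?(le_trans hu) ?(le_trans hv) //; lra.
have := few_blocks_mass tP h0 H0 blocks cP.
rewrite -sum_mass.
under [X in _ <= _ * X]eq_bigr do rewrite massE.
rewrite -big_mkcond /=; apply: le_trans.
(* Distinct blocks on which [f] meets its target give distinct merging vertices. *)
rewrite big_mkcondr /= [leLHS]big_mkcond [leRHS]big_mkcond /=; apply: ler_sum => f _.
rewrite massE; case: eqP => [ef|_]; last by case: ifP.
case: (boolP (#|merging G f C| < alpha)%N) => m; last first.
  by case: ifP => _ //; apply: mu_range_ge0.
rewrite [X in _ <= X]ifT //; apply: leq_ltn_trans m.
apply: leq_trans (leq_imset_card (fun vc : T * bool => pblock P vc.1) _).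
apply: subset_leq_card; apply/subsetP => B; rewrite inE => /andP[BP pass].
have [u [v [eB uC uf vf Guv]]] := edgeP B BP.
rewrite eB in BP pass.
have [c mc] := merging_of_block f0x tP BP uC uf vf Guv ef pass.
by apply/imsetP; exists (u, c) => //=; rewrite (def_pblock tP BP) ?set21.
Qed.

(** Sum the bound of [cell_fails] over all explorations. *)
Lemma escape_fails alpha x : (128 * alpha <= K)%N ->
  \sum_(f : state T | ~~ escape_ok G alpha f x) mu p f <= (1 / 2) ^+ alpha.
Proof.
move=> aK.
have <- : (1 / 2 : R) ^+ alpha * \sum_(f : state T) mu p f = (1 / 2) ^+ alpha.
  by rewrite sum_mu mulr1.
rewrite (partition_big (explored G x) xpredT) //=.
rewrite [X in _ <= _ * X](partition_big (explored G x) xpredT) //= mulr_sumr.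
apply: ler_sum => j _.
case: (pickP (fun f => ~~ escape_ok G alpha f x && (explored G x f == j))) => [f0|none].
  case/andP; rewrite negb_imply -ltnNge => /andP[/andP[f0x mfar] _] /eqP <-.
  apply: le_trans (cell_fails f0x mfar aK).
  rewrite [leLHS]big_mkcond [leRHS]big_mkcond /=; apply: ler_sum => f _.
  rewrite negb_imply -ltnNge andbC.
  case: eqP => [ef|_] //=; have [-> _] := exploredE ef.
  case: (_ < alpha)%N; rewrite ?andbF //= andbT.
  by case: ifP => _ //; apply: mu_range_ge0.
rewrite big_pred0; last by move=> f; apply: none.
by rewrite mulr_ge0 ?exprn_ge0 ?sumr_ge0 // => *; rewrite ?mu_range_ge0 //; lra.
Qed.

Lemma good_fails alpha : (64 * (386 * alpha) <= K)%N ->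
  \sum_(f : state T | ~~ good G alpha f) mu p f <= (4 * #|T|)%:R * (1 / 2) ^+ alpha.
Proof.
move=> aK.
have union (A B D : pred (state T)) : (forall f, D f -> A f || B f) ->
    \sum_(f | D f) mu p f <= \sum_(f | A f) mu p f + \sum_(f | B f) mu p f.
  move=> sub; rewrite [leLHS]big_mkcond [X in _ <= X + _]big_mkcond.
  rewrite [X in _ <= _ + X]big_mkcond -big_split /=; apply: ler_sum => f _.
  have := sub f; have := mu_range_ge0 f.
  by case: (D f) => [? /(_ isT)|? _]; case: (A f); case: (B f) => //= *; lra.
pose e1 (f : state T) := [exists x, ~~ escape_ok G alpha f x].
pose e2 (f : state T) := (#|[set x in [set: T] | f x == None]| < 386 * alpha)%N.
apply: (@le_trans _ _ ((2 * #|T|)%:R * (1 / 2) ^+ alpha +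
   (#|T|%:R * (1 / 2) ^+ alpha + (1 / 2) ^+ alpha))).
  apply: le_trans (union (fun f => ~~ degree_ok G alpha f) (fun f => e1 f || e2 f) _ _) _.
    move=> f; rewrite /good !negb_and negb_forall -ltnNge /e1 /e2.
    have -> : [set y in [set: T] | f y == None] = [set y | f y == None] by apply/setP => y; rewrite !inE.
    by [].
  apply: lerD; first by apply: degree_fails; lia.
  apply: le_trans (union e1 e2 _ _) _ => //; apply: lerD.
    apply: (@le_trans _ _ (\sum_(x : T) \sum_(f : state T | ~~ escape_ok G alpha f x) mu p f)).
      rewrite (exchange_big_dep xpredT) //= [leLHS]big_mkcond; apply: ler_sum => f _ /=.
      case: ifPn => [/existsP[x nx]|_]; last by apply: sumr_ge0 => *; apply: mu_range_ge0.
      by rewrite (bigD1 x) //= lerDl; apply: sumr_ge0 => *; apply: mu_range_ge0.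
    apply: (@le_trans _ _ (\sum_(x : T) (1 / 2) ^+ alpha)).
      by apply: ler_sum => x _; apply: escape_fails; lia.
    by rewrite sumr_const mulr_natl.
  apply: (@le_trans _ _ ((1 / 2) ^+ (386 * alpha)%N)).
    by apply: few_of_colour; rewrite cardsT; lia.
  by apply: ler_wiXn2l; [lra|lra|lia].
have n1 : 1 <= #|T|%:R :> R by rewrite ler1n; lia.
have a0 : 0 <= (1 / 2 : R) ^+ alpha by apply: exprn_ge0; lra.
by rewrite !natrM; nra.
Qed.
End Rarity.

(** * Few components with high probability; from partial to full colourings *)

Section Expectation.
Local Open Scope ring_scope.
Variables (R : rcfType) (T : finType) (G : sgraph T) (K : nat).
Hypothesis robustG : forall S : {set T}, (#|S| <= K)%N -> connected_without G S.
Hypothesis K_lt : (K < #|T|)%N.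
Implicit Types (f : state T).

Lemma excess_le f : (excess G f <= #|T|)%N.
Proof.
apply: leq_trans (leq_subr _ _) _.
by apply: leq_trans (leq_imset_card _ _) (max_card _).
Qed.

(** The factor multiplying [mu p f] in Russo's formula for the excess. *)
Definition drift f : R :=
  \sum_(v | f v == None) \sum_(c : bool)
    ((excess G (recolour f v (Some c)))%:R - (excess G f)%:R).

Lemma drift_good beta f : (0 < beta)%N -> good G (3 * beta) f ->
  drift f <= - beta%:R * (excess G f)%:R.
Proof.
move=> b0 gf; have b3 : (0 < 3 * beta)%N by rewrite muln_gt0.
have dE : drift f =
    (\sum_(v | f v == None) \sum_(c : bool) excess G (recolour f v (Some c)))%:R -
    (\sum_(v | f v == None) \sum_(c : bool) excess G f)%:R.
  rewrite !natr_sum -sumrB; apply: eq_bigr => v _.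
  by rewrite !natr_sum -sumrB.
have := excess_drop b3 gf; rewrite -(ler_nat R) natrD !natrM dE; lra.
Qed.

(** For states that are not [good]: colouring one vertex creates at most one
    component. *)
Lemma drift_any f : drift f <= (2 * #|T|)%:R.
Proof.
apply: (@le_trans _ _ (\sum_(v : T) \sum_(c : bool) 1)); last first.
  under eq_bigr do rewrite big_bool /=.
  by rewrite sumr_const -mulr_natl natrM; lra.
rewrite /drift big_mkcond; apply: ler_sum => v _.
case: ifPn => [/eqP fv|_]; last by apply: sumr_ge0.
apply: ler_sum => c _; rewrite lerBlDr nat1r ler_nat.
by have := card_components_recolour G c fv; rewrite /excess; lia.
Qed.

Lemma expected_excess beta : (0 < beta)%N -> (64 * (386 * (3 * beta)) <= K)%N ->
  \sum_(f : state T) mu (1 / 4%:R) f * (excess G f)%:R <=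
  (9%:R / 10%:R) ^+ beta * #|T|%:R +
  ((beta + 2) * #|T|)%:R * ((4 * #|T|)%:R * (1 / 2) ^+ (3 * beta)) :> R.
Proof.
move=> b0 bK; set eps := _ * (_ * _).
have [P PE dP] := russo (fun f => (excess G f)%:R : R).
have half0 : 0 <= (1 / 2 : R) by lra.
have eps0 : 0 <= eps by rewrite !mulr_ge0 // exprn_ge0.
rewrite -PE; apply: le_trans (poly_decay (beta := beta) eps0 _ _) _.
- move=> p pb; rewrite PE; apply: sumr_ge0 => f _.
  by rewrite mulr_ge0 // (mu_range_ge0 pb).
- move=> p pb; rewrite dP PE mulr_sumr.
  have few := good_fails pb robustG K_lt bK.
  apply: (@le_trans _ _ (\sum_f (- beta%:R * (mu p f * (excess G f)%:R)) +
     \sum_(f | ~~ good G (3 * beta) f) ((beta + 2) * #|T|)%:R * mu p f)); last first.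
    by rewrite lerD2l -mulr_sumr ler_wpM2l.
  rewrite [X in _ <= _ + X]big_mkcond -big_split /=; apply: ler_sum => f _.
  have m0 := mu_range_ge0 pb f.
  case: ifPn => [_|/negPn gf]; last first.
    by rewrite addr0 mulrCA ler_wpM2l //; apply: drift_good.
  have dle := drift_any f.
  have ele : (excess G f)%:R <= #|T|%:R :> R by rewrite ler_nat excess_le.
  rewrite mulrCA [X in _ + X]mulrC -mulrDr ler_wpM2l //.
  apply: (le_trans dle); rewrite !natrM natrD.
  have : 0 <= beta%:R * (#|T|%:R - (excess G f)%:R) :> R by rewrite mulr_ge0 // subr_ge0.
  by rewrite mulrBr; lra.
rewrite lerD2r ler_wpM2l ?exprn_ge0 //; first by lra.
rewrite PE; apply: (@le_trans _ _ (\sum_(f : state T) mu (1 / 8%:R) f * #|T|%:R)).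
  apply: ler_sum => f _; rewrite ler_wpM2l ?ler_nat ?excess_le //.
  by apply: mu_range_ge0; apply/andP; split; lra.
by rewrite -mulr_suml sum_mu mul1r.
Qed.

Lemma many_components_rare beta : (0 < beta)%N -> (64 * (386 * (3 * beta)) <= K)%N ->
  \sum_(f : state T | (2 < #|components G f|)%N || ~~ degree_ok G (3 * beta) f)
     mu (1 / 4%:R) f <= 15%:R * #|T|%:R ^+ 3 * (9%:R / 10%:R) ^+ beta :> R.
Proof.
move=> b0 bK; have pb : 1 / 8%:R <= (1 / 4%:R : R) <= 1 / 4%:R by apply/andP; split; lra.
have m0 f := mu_range_ge0 pb f.
have eE := expected_excess b0 bK.
have dE : \sum_(f : state T | ~~ degree_ok G (3 * beta) f) mu (1 / 4%:R : R) f <=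
    (2 * #|T|)%:R * (1 / 2) ^+ (3 * beta).
  by apply: (degree_fails pb robustG K_lt); lia.
apply: (@le_trans _ _ (\sum_(f : state T) mu (1 / 4%:R) f * (excess G f)%:R +
   \sum_(f : state T | ~~ degree_ok G (3 * beta) f) mu (1 / 4%:R : R) f)).
  rewrite big_mkcond [X in _ + X]big_mkcond -big_split /=; apply: ler_sum => f _.
  have mx : 0 <= mu (1 / 4%:R) f * (excess G f)%:R :> R by rewrite mulr_ge0.
  case: ifPn => [|_]; last by case: ifP; rewrite ?addr0 // addr_ge0.
  case: (degree_ok _ _ _) => /=; last by rewrite lerDr.
  by rewrite orbF addr0 => lt; rewrite ler_peMr // ler1n /excess subn_gt0.
apply: (le_trans (lerD eE dE)).
set x : R := (9%:R / 10%:R) ^+ beta; set y : R := (1 / 2) ^+ (3 * beta).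
have yx : y <= x.
  have h3 : (1 / 2 : R) ^+ 3 = 1 / 8%:R by rewrite !exprS expr0; field.
  by rewrite /y /x exprM h3; apply: lerXn2r; rewrite ?nnegrE; lra.
have y0 : 0 <= y by rewrite exprn_ge0 //; lra.
have x0 : 0 <= x by rewrite exprn_ge0 //; lra.
rewrite !natrM natrD; set n : R := #|T|%:R.
have n1 : 1 <= n by rewrite ler1n; move: K_lt; lia.
have bn : beta%:R <= n by rewrite ler_nat; move: K_lt; lia.
have n2 : n <= n ^+ 2 by rewrite expr2; nra.
have n3 : n ^+ 2 <= n ^+ 3 by rewrite exprS ler_peMl //; nra.
have s1 : (beta%:R + 2) * n <= 3%:R * n ^+ 2.
  by rewrite expr2 mulrA ler_wpM2r; lra.
have s2 : (beta%:R + 2) * n * (4%:R * n * y) <= 12%:R * n ^+ 3 * x.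
  apply: (@le_trans _ _ (3%:R * n ^+ 2 * (4%:R * n * x))).
    by apply: ler_pM; rewrite ?mulr_ge0 ?addr_ge0 ?ler_wpM2l ?mulr_ge0 //; lra.
  by rewrite le_eqVlt; apply/orP; left; apply/eqP; ring.
have s3 : x * n <= n ^+ 3 * x by rewrite mulrC ler_wpM2r //; lra.
have s4 : 2 * n * y <= 2 * n ^+ 3 * x.
  by apply: ler_pM; rewrite ?mulr_ge0 //; lra.
lra.
Qed.
End Expectation.

Section Thinning.
Local Open Scope ring_scope.
Variables (R : rcfType) (T : finType).
Implicit Types (f : state T) (g : {ffun T -> bool}).

Definition sampled_from f g := [forall v, (f v == None) || (f v == Some (g v))].

(** Choose a uniform colouring [g] and uncolour every vertex with probability [1/2];
    this gives the partial colouring of distribution [mu (1/4)]. Given [g],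
    uncolouring [S] and keeping [Q] has probability at least [(1/2)^(s+3)], and
    this forces [F]. So if every [g] has such a pair of sets, then [F] is not
    too rare. *)
Lemma thinning_lower (F : pred (state T)) s :
  (forall g, exists S Q : {set T}, [/\ (#|S| <= s)%N, (#|Q| <= 3)%N, [disjoint S & Q] &
     forall f, sampled_from f g -> (forall v, v \in S -> f v = None) ->
       (forall v, v \in Q -> f v != None) -> F f]) ->
  (1 / 2 : R) ^+ (s + 3) <= \sum_(f : state T | F f) mu (1 / 4%:R) f.
Proof.
move=> bad.
(* The joint law, at one vertex, of a uniform colour [b] and its thinning [o]. *)
pose q (o : option bool) (b : bool) : R := if o is Some c then (c == b)%:R / 4%:R else 1 / 4%:R.
have q0 o b : 0 <= q o b by case: o => [c|] /=; rewrite divr_ge0.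
have muE f : mu (1 / 4%:R) f = \sum_(g : {ffun T -> bool}) \prod_v q (f v) (g v).
  rewrite -(bigA_distr_bigA (fun v b => q (f v) b)) /mu /mass; apply: eq_bigr => v _; rewrite big_bool /=.
  by case: (f v) => [[]|] /=; field.
under eq_bigr do rewrite muE.
rewrite exchange_big /=.
have <- : \sum_(g : {ffun T -> bool}) (1 / 2 : R) ^+ #|T| * (1 / 2) ^+ (s + 3) = (1 / 2) ^+ (s + 3).
  rewrite sumr_const card_ffun card_bool -[LHS]mulr_natl mulrA natrX -exprMn.
  by rewrite [2 * _](_ : _ = 1) ?expr1n ?mul1r //; field.
apply: ler_sum => g _; have [S [Q [cS cQ dis FP]]] := bad g.
pose L v (o : option bool) : bool := if v \in S then o == None else if v \in Q then o != None else true.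
pose y : R := \sum_(f : state T) \prod_v (q (f v) (g v) * (L v (f v))%:R).
apply: (@le_trans _ _ y); rewrite {}/y.
  rewrite -(bigA_distr_bigA (fun v o => q o (g v) * (L v o)%:R)).
  rewrite (eq_bigr (fun v => (1 / 2) * (if v \in S :|: Q then 1 / 2 else 1))); last first.
    move=> v _; rewrite sum_option big_bool /= /L inE.
    case: (boolP (v \in S)) => vS /=; first by case: (g v) => /=; field.
    by case: ifP => _; case: (g v) => /=; field.
  rewrite big_split prodr_const /= ler_wpM2l ?exprn_ge0 //; first by lra.
  rewrite -big_mkcond prodr_const; apply: ler_wiXn2l; try lra.
  by apply: leq_trans (leq_card_setU _ _).1 (leq_add cS cQ).
rewrite [leRHS]big_mkcond /=; apply: ler_sum => f _.
case: (boolP [forall v, ((f v == None) || (f v == Some (g v))) && L v (f v)]).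
  move/forallP=> ok; rewrite ifT; last first.
    apply: FP; first by apply/forallP => v; case/andP: (ok v).
      by move=> v vS; case/andP: (ok v) => _; rewrite /L vS => /eqP.
    move=> v vQ; case/andP: (ok v) => _; rewrite /L vQ; case: ifP => // vS.
    by have := disjointFr dis vS; rewrite vQ.
  apply: ler_prod => v _; rewrite mulr_ge0 ?ler0n //=.
  by rewrite ler_piMr // lern1 leq_b1.
case/forallPn => v nv; rewrite (bigD1 v) //=.
suff -> : q (f v) (g v) * (L v (f v))%:R = 0.
  by rewrite mul0r; case: ifP => // _; apply: prodr_ge0.
move: nv; rewrite negb_and negb_or; case: (f v) => [c|] //=.
  case/orP => [ncg|/negPf ->]; last by rewrite mulr0.
  by rewrite [c == _]negbTE ?mul0r //; apply: contra ncg => /eqP ->.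
by move/negPf=> ->; rewrite mulr0.
Qed.
End Thinning.

(** * Repairing a colouring with two parts *)

Section Colouring.
Variables (T : finType) (G : sgraph T).
Implicit Types (g : T -> bool) (S : {set T}).

Definition cut_rel g : rel T := [rel x y | G x y && (g x != g y)].

Lemma cut_sym g : symmetric (cut_rel g).
Proof. by move=> x y; rewrite /cut_rel /= adj_sym eq_sym. Qed.

Lemma cut_irrefl g : irreflexive (cut_rel g).
Proof. by move=> x; rewrite /cut_rel /= adj_irrefl. Qed.

Definition cut_graph g : sgraph T := SGraph (cut_sym g) (@cut_irrefl g).

Lemma cut_graph_spanning g : spanning_subgraph (cut_graph g) G.
Proof. by move=> x y /andP[]. Qed.

Lemma cut_graph_bipartite g : bipartite (cut_graph g).
Proof. by exists [set x | g x] => x y /andP[_]; rewrite !inE. Qed.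

Definition linked g S : rel T := connect (del_vertices (cut_graph g) S).

Lemma del_cut_graphE g S x y :
  del_vertices (cut_graph g) S x y = [&& x \notin S, y \notin S, G x y & g x != g y].
Proof. by []. Qed.

Lemma linkedC g S x y : linked g S x y = linked g S y x.
Proof.
apply: sym_connect_sym => a b; rewrite !del_cut_graphE adj_sym eq_sym.
by case: (a \notin S); case: (b \notin S).
Qed.

(** Deleting at most [t] vertices leaves at most two components, in the cut graph
    of [g]. *)
Definition two_parts g t :=
  [forall S : {set T}, forall x, forall y, forall z,
    [&& #|S| <= t, x \notin S, y \notin S & z \notin S] ==>
    [|| linked g S x y, linked g S y z | linked g S z x]].

Definition degrees_ge alpha g :=
  [forall v, forall c, alpha <= #|[set y | G v y & g y == c]|].

Lemma two_partsP g t S x y z : two_parts g t -> #|S| <= t ->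
  x \notin S -> y \notin S -> z \notin S ->
  [|| linked g S x y, linked g S y z | linked g S z x].
Proof.
move=> /forallP/(_ S)/forallP/(_ x)/forallP/(_ y)/forallP/(_ z)/implyP H a b c d.
by apply: H; rewrite a b c d.
Qed.

(** If the cut graph of [g] has a small separator [S], with sides [X] and [Y], then
    after exchanging the colours on [X] all edges of [G] between [X] and [Y] are
    in the cut graph. Deleting a further small set [S'] leaves each side
    connected, as there are at most two components, and the sides have more than
    [q] vertices by the degree condition; connectivity of [G] gives an edge
    between them. The majority colouring on [S] attaches the rest. *)
Lemma robust_after_flip g alpha t q :
  (forall S, #|S| <= 2 * q -> connected_without G S) ->
  degrees_ge alpha g -> two_parts g t -> 2 * q < alpha -> 2 * q <= t ->
  exists h, forall S, #|S| <= q -> connected_without (cut_graph h) S.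
Proof.
move=> robustG dg tp qa qt.
case: (boolP [forall S : {set T}, forall x, forall y,
    [&& #|S| <= q, x \notin S & y \notin S] ==> linked g S x y]) => [ok|].
  exists g => S Sq x y xS yS.
  move/forallP/(_ S)/forallP/(_ x)/forallP/(_ y)/implyP: ok; apply.
  by rewrite Sq xS yS.
case/forallPn => S /forallPn[x /forallPn[y]]; rewrite negb_imply.
case/andP => /and3P[Sq xS yS] nxy.
pose X := [set z | linked g S x z]; pose Y := ~: (S :|: X).
have inX z : (z \in X) = linked g S x z by rewrite inE.
have edgeX a b : a \notin S -> b \notin S -> G a b -> g a != g b -> (a \in X) = (b \in X).
  move=> aS bS Gab gab; rewrite !inX.
  have e : del_vertices (cut_graph g) S a b by rewrite del_cut_graphE aS bS Gab.
  apply/idP/idP => c; first exact: connect_trans c (connect1 e).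
  by apply: connect_trans c _; rewrite -/(linked g S b a) linkedC; apply: connect1.
have xX : x \in X by rewrite inX /linked connect0.
have XS z : z \in X -> z \notin S.
  rewrite inX => c; have : z \in [pred z | z \notin S]; last by [].
  by apply: connect_invariant c => // a b _ /and3P[].
have inY z : (z \in Y) = (z \notin S) && (z \notin X) by rewrite in_setC in_setU negb_or.
have yY : y \in Y by rewrite inY yS inX.
have big_side v (Z : {set T}) : v \notin S ->
    (forall w, w \notin S -> G v w -> g v != g w -> w \in Z) -> q < #|Z|.
  move=> vS cl; have /forallP/(_ (~~ g v)) := forallP dg v.
  set W := [set w | _ & _] => aW.
  have sub : W :\: S \subset Z.
    apply/subsetP => w; rewrite !inE => /and3P[wS Gvw /eqP gw]; apply: cl => //.
    by rewrite gw; case: (g v).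
  have := subset_leq_card sub; rewrite cardsD.
  by have := subset_leq_card (subsetIr W S); lia.
have Xq : q < #|X|.
  by apply: (big_side x) => // w wS Gxw gxw; rewrite -(edgeX x).
have Yq : q < #|Y|.
  apply: (big_side y) => // w wS Gyw gyw; rewrite inY wS -(edgeX y) //.
  by move: yY; rewrite inY yS.
pose g1 z := if z \in X then ~~ g z else g z.
pose nb (s : T) (c : bool) := [set w | [&& w \notin S, G s w & g1 w == c]].
(* On [S], the colour is chosen to differ from the colour of more than [q]
   neighbours outside [S]. *)
pose h z := if z \in S then ~~ (q < #|nb z true|) else g1 z.
have hX z : z \in X -> h z = ~~ g z by move=> zX; rewrite /h (negPf (XS z zX)) /g1 zX.
have hY z : z \in Y -> h z = g z.
  by rewrite inY => /andP[zS zX]; rewrite /h (negPf zS) /g1 (negPf zX).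
have hS s : s \in S -> q < #|nb s (~~ h s)|.
  move=> sS; rewrite /h sS; case: (boolP (q < #|nb s true|)) => // few.
  have deg c := forallP (forallP dg s) c; have := (deg true, deg false).
  set A := [set w | _ & _]; set B := [set w | _ & _]; case=> aA aB /=.
  have dis : A :&: B = set0.
    by apply/setP => w; rewrite !inE; case: (g w); rewrite ?andbF.
  have cAB : #|A :|: B| = #|A| + #|B| by rewrite cardsU dis cards0 subn0.
  have sub : (A :|: B) :\: S \subset nb s true :|: nb s false.
    by apply/subsetP => w; rewrite !inE; case: (w \in S); case: (G s w) => //=; case: (g1 w).
  have := subset_leq_card sub; rewrite cardsD.
  have := (leq_card_setU (nb s true) (nb s false)).1.
  have := subset_leq_card (subsetIr (A :|: B) S); rewrite cAB; lia.
exists h => S' Sq'.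
have outside (Z : {set T}) : q < #|Z| -> exists2 z, z \in Z & z \notin S'.
  move=> qZ; apply/subsetPn; apply/negP => /subset_leq_card; lia.
have [x' x'X x'S'] := outside X Xq; have [y' y'Y y'S'] := outside Y Yq.
set U := S :|: S'.
have Ucard : #|U| <= 2 * q by rewrite mul2n -addnn; apply: leq_trans (leq_card_setU S S').1 (leq_add Sq Sq').
have inU z : z \notin S -> z \notin S' -> z \notin U by move=> a b; rewrite inE negb_or a b.
have Uout z : z \notin U -> z \notin S /\ z \notin S' by rewrite inE negb_or => /andP[].
have linkX a b : linked g U a b -> (a \in X) = (b \in X).
  move=> lab; apply: (closed_connect _ lab) => c d /and3P[/Uout[cS _] /Uout[dS _] /andP[Gcd gcd]].
  exact: edgeX.
have keep a b : linked g U a b -> linked h S' a b.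
  apply: connect_sub => c d /and3P[/Uout[cS cS'] /Uout[dS dS'] /andP[Gcd gcd]].
  apply: connect1; rewrite del_cut_graphE cS' dS' Gcd /h (negPf cS) (negPf dS) /g1.
  by rewrite (edgeX c d) //; case: ifP => _ //=; rewrite (inj_eq negb_inj).
have YX z : z \in Y -> z \notin X by rewrite inY => /andP[].
have YS z : z \in Y -> z \notin S by rewrite inY => /andP[].
have claimX a : a \in X -> a \notin S' -> linked h S' a x'.
  move=> aX aS'; have := two_partsP tp (leq_trans Ucard qt)
    (inU a (XS a aX) aS') (inU x' (XS x' x'X) x'S') (inU y' (YS y' y'Y) y'S').
  case/or3P => [/keep //|/linkX|/linkX]; first by rewrite x'X (negPf (YX y' y'Y)).
  by rewrite aX (negPf (YX y' y'Y)).
have claimY a b : a \in Y -> a \notin S' -> b \in Y -> b \notin S' -> linked h S' a b.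
  move=> aY aS' bY bS'; have := two_partsP tp (leq_trans Ucard qt)
    (inU a (YS a aY) aS') (inU b (YS b bY) bS') (inU x' (XS x' x'X) x'S').
  case/or3P => [/keep //|/linkX|/linkX]; first by rewrite x'X (negPf (YX b bY)).
  by rewrite x'X (negPf (YX a aY)).
have [a [b [aX aS' bY bS' Gab]]] : exists a b,
    [/\ a \in X, a \notin S', b \in Y, b \notin S' & G a b].
  case: (boolP [exists a, exists b, [&& a \in X, a \notin S', b \in Y, b \notin S' & G a b]]).
    by case/existsP => a /existsP[b /and5P[? ? ? ? ?]]; exists a, b.
  move=> none; have : y' \in X; last by rewrite (negPf (YX y' y'Y)).
  have conn : connect (del_vertices G U) x' y'.
    by apply: robustG Ucard _ _ _ _; apply: inU => //; [apply: XS|apply: YS].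
  have : y' \in [pred z | (z \in X) && (z \notin S')]; last by case/andP.
  apply: connect_invariant conn; last by rewrite inE x'X.
  move=> a b /andP[aX aS'] /and3P[_ /Uout[bS bS'] Gab].
  rewrite inE bS' andbT; apply: contraNT none => bX.
  by apply/existsP; exists a; apply/existsP; exists b; rewrite aX aS' inY bS bX bS'.
have lab : linked h S' b a.
  rewrite linkedC; apply: connect1; rewrite del_cut_graphE aS' bS' Gab (hX a aX) (hY b bY) /=.
  case: (eqVneq (g a) (g b)) => [->|ne]; first by case: (g b).
  by move: (YX b bY); rewrite -(edgeX a b (XS a aX) (YS b bY)) ?aX.
have offS u : u \notin S -> u \notin S' -> linked h S' u x'.
  move=> uS uS'; case: (boolP (u \in X)) => uX; first exact: claimX.
  apply: connect_trans (claimY u b _ uS' bY bS') _; first by rewrite inY uS.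
  by apply: connect_trans lab _; apply: claimX.
have all_to u : u \notin S' -> linked h S' u x'.
  move=> uS'; case: (boolP (u \in S)) => uS; last exact: offS.
  have [w] := outside _ (hS u uS); rewrite inE => /and3P[wS Guw /eqP gw] wS'.
  apply: connect_trans (offS w wS wS'); apply: connect1.
  rewrite del_cut_graphE uS' wS' Guw [h w]/h (negPf wS) gw.
  by case: (h u).
move=> u v uS' vS'; apply: connect_trans (all_to u uS') _.
by rewrite -/(linked h S' x' v) linkedC; apply: all_to.
Qed.

Local Open Scope ring_scope.

(** If every colouring failed, then by [thinning_lower] a random partial colouring
    would have three components or a vertex of low degree too often. *)
Lemma good_colouring (R : rcfType) (K beta t : nat) :
  (forall S, (#|S| <= K)%N -> connected_without G S) -> (K < #|T|)%N ->
  (0 < beta)%N -> (64 * (386 * (3 * beta)) <= K)%N ->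
  15%:R * #|T|%:R ^+ 3 * (9%:R / 10%:R) ^+ beta < (1 / 2 : R) ^+ (t + 3) ->
  exists2 g, degrees_ge (3 * beta) g & two_parts g t.
Proof.
move=> robustG KT b0 bK small.
case: (pickP (fun g : {ffun T -> bool} => degrees_ge (3 * beta) g && two_parts g t)).
  by move=> g /andP[? ?]; exists g.
move=> none; exfalso.
have := many_components_rare R robustG KT b0 bK.
apply/negP; rewrite -ltNge; apply: (lt_le_trans small).
apply: thinning_lower => g; have /negbT := none g; rewrite negb_and => /orP[].
  (* A vertex of low degree in the colouring keeps a low degree after thinning. *)
  case/forallPn => v /forallPn[c]; rewrite -ltnNge => lt.
  exists set0, set0; split; rewrite ?cards0 -?setI_eq0 ?set0I //.
  move=> f /forallP fg _ _; apply/orP; right; apply/forallPn; exists v; apply/forallPn; exists c.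
  rewrite -ltnNge; apply: leq_ltn_trans lt; apply: subset_leq_card; apply/subsetP => y.
  rewrite !inE => /andP[-> /eqP fy] /=; have := fg y; rewrite fy => /orP[//|/eqP[->]].
  exact: eqxx.
case/forallPn => S /forallPn[x /forallPn[y /forallPn[z]]]; rewrite negb_imply.
case/andP => /and4P[St xS yS zS]; rewrite !negb_or => /and3P[nxy nyz nzx].
(* Uncolouring [S] and keeping [x], [y] and [z] gives three components. *)
exists S, [set x; y; z]; split=> //.
- apply: leq_trans (leq_card_setU _ _).1 _; rewrite cards1 cards2.
  by case: (x != y).
- rewrite disjoint_sym disjoint_subset; apply/subsetP => w; rewrite !inE.
  by case/orP => [/orP[]|] /eqP ->.
move=> f /forallP fg fS fQ; apply/orP; left.
have [fx fy fz] : [/\ f x != None, f y != None & f z != None].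
  by split; apply: fQ; rewrite !inE eqxx ?orbT.
have sub a b : connect (sampled_edge G f) a b -> linked g S a b.
  apply: connect_sub => c d; rewrite sampled_edgeE => /andP[Gcd op]; apply: connect1.
  have out w : f w != None -> w \notin S by apply: contraNN => /fS ->.
  rewrite del_cut_graphE Gcd; have := fg c; have := fg d; have := out c; have := out d.
  case: (f c) op => [k|//]; case: (f d) => [k'|//] /= kk' -> // -> // /eqP[<-] /eqP[<-].
  by [].
apply/card_gt2P; exists (component G f x), (component G f y), (component G f z).
split; first by split; apply: mem_components.
split; [apply: contra nxy | apply: contra nyz | apply: contra nzx];
  by move=> /eqP e; apply: sub; rewrite -in_component e component_refl.
Qed.
End Colouring.

Section Size.
Local Open Scope ring_scope.

(** The parameters are [t = 2 * q], [beta = 28 * q], and [alpha = 3 * beta]: since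
    [(9/10)^28 <= (1/2)^4], the failure probability [15 n^3 (9/10)^beta] is at
    most [15 n^3 (1/2)^(4 q)], below the bound [(1/2)^(2 q + 3)]. *)
Lemma bipartite_of_size (R : rcfType) (T : finType) (G : sgraph T) (K q : nat) :
  (forall S : {set T}, (#|S| <= K)%N -> connected_without G S) ->
  (K < #|T|)%N -> (64 * (386 * (3 * (28 * q))) <= K)%N ->
  120%:R * #|T|%:R ^+ 3 < 2 ^+ (2 * q) :> R ->
  exists H : sgraph T, [/\ spanning_subgraph H G, bipartite H &
    forall S : {set T}, (#|S| <= q)%N -> connected_without H S].
Proof.
move=> robustG KT qK big.
have n1 : 1 <= #|T|%:R ^+ 3 :> R by rewrite exprn_ege1 // ler1n; lia.
have q0 : (0 < q)%N by case: q big {qK} => //; rewrite muln0 expr0; lra.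
have [] := @good_colouring T G R K (28 * q) (2 * q) robustG KT _ _ _; try lia.
  have p28 : (9%:R / 10%:R : R) ^+ 28 <= (1 / 2) ^+ 4.
    have p7 : (9%:R / 10%:R : R) ^+ 7 <= 1 / 2 by rewrite !exprS expr0; lra.
    rewrite (exprM _ 7 4); apply: lerXn2r; rewrite ?nnegrE ?exprn_ge0 //; lra.
  have half_inv m : (1 / 2 : R) ^+ m = (2 ^+ m)^-1 by rewrite div1r exprVn.
  apply: (@le_lt_trans _ _ (15%:R * #|T|%:R ^+ 3 * (1 / 2) ^+ (2 * q + 2 * q)%N)).
    rewrite ler_wpM2l ?mulr_ge0 ?exprn_ge0 //.
    rewrite exprM (_ : (2 * q + 2 * q = 4 * q)%N); last lia.
    by rewrite exprM; apply: lerXn2r; rewrite ?nnegrE ?exprn_ge0 //; lra.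
  have t0 : 0 < 2 ^+ (2 * q) :> R by rewrite exprn_gt0.
  have e8 : (1 / 2 : R) ^+ 3 = 1 / 8%:R by rewrite !exprS expr0; field.
  rewrite exprD (exprD _ _ 3) mulrA e8 mulrC ltr_pM2l; last first.
    by rewrite half_inv invr_gt0.
  by rewrite half_inv ltr_pdivrMr //; lra.
move=> g dg tp.
have robust2q (S : {set T}) : (#|S| <= 2 * q)%N -> connected_without G S.
  by move=> Sq; apply: robustG; lia.
have q_lt : (2 * q < 3 * (28 * q))%N by lia.
have [h hP] := robust_after_flip robust2q dg tp q_lt (leqnn _).
by exists (cut_graph G h); split; [apply: cut_graph_spanning|apply: cut_graph_bipartite|].
Qed.
End Size.

(** * Asymptotics *)

From mathcomp Require Import all_classical all_reals all_analysis.
Import numFieldNormedType.Exports.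

Unset Implicit Arguments.
Set Strict Implicit.
Set Printing Implicit Defensive.

Local Open Scope classical_set_scope.
Local Open Scope ring_scope.

Lemma nat_below (R : realType) (k : R) : 0 < k -> exists K : nat, K%:R < k <= K.+1%:R.
Proof.
move=> k0; have ex : exists m : nat, k <= m.+1%:R.
  by exists (Num.truncn k); apply/ltW/truncnS_gt.
case: (ex_minnP ex) => -[|m] km mmin; [exists 0%N|exists m.+1]; rewrite km andbT //.
by rewrite ltNge; apply/negP => /mmin; rewrite ltnn.
Qed.

(** With [q] proportional to [k], the hypothesis on [k / ln n] makes [2 ^ q] larger
    than a large power of [n], and [bipartite_of_size] applies. *)
Theorem theorem1p6 (R : realType) :
  exists2 c : R, 0 < c &
    forall w : nat -> R, w n @[n --> \oo] --> +oo ->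
    exists N : nat, forall (n : nat) (T : finType) (G : sgraph T) (k : R),
      (N <= n)%N -> #|T| = n ->
      w n <= k / ln n%:R ->
      r_connected k G ->
      exists H : sgraph T,
        [/\ spanning_subgraph H G, bipartite H & r_connected (c * k) H].
Proof.
have [C CE] : exists C : nat, C = (64 * (386 * (3 * 28)))%N by exists (64 * (386 * (3 * 28)))%N.
have C1 : (0 < C)%N by rewrite CE !muln_gt0.
have C0 : 0 < C%:R :> R by rewrite ltr0n.
exists C%:R^-1; first by rewrite invr_gt0.
have ln2 : 0 < ln 2 :> R by rewrite ln_gt0 // ltr1n.
move=> w /cvgryPge /(_ (16%:R * C%:R / ln 2)) [N _ wN].
exists (maxn N 2) => n T G k Nn Tn wk [k0 kT robust].
have [nN n2] : (N <= n)%N /\ (1 < n)%N by move: Nn; rewrite geq_max => /andP[].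
have lnn : 0 < ln n%:R :> R by rewrite ln_gt0 // ltr1n.
have kbig : 16%:R * C%:R / ln 2 * ln n%:R <= k.
  by rewrite -ler_pdivlMr //; apply: le_trans wk; apply: wN.
have [K /andP[Kk kK]] := nat_below _ _ k0.
(* [K] is the largest number of vertices whose deletion leaves [G] connected by
   hypothesis, and [q + 1 >= k / C]. *)
pose q := (K %/ C)%N.
have qK : (64 * (386 * (3 * (28 * q))) <= K)%N.
  have -> : (64 * (386 * (3 * (28 * q))) = C * q)%N by rewrite CE !mulnA.
  by rewrite mulnC leq_trunc_div.
have kq : C%:R^-1 * k <= q.+1%:R.
  rewrite ler_pdivrMl // -natrM; apply: (le_trans kK); rewrite ler_nat.
  by rewrite mulnC ltn_ceil.
(* The exponent [16] leaves room for the factors [120 n^3] and [2]. *)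
have n16 : n%:R ^+ 16 <= 2 ^+ q.+1 :> R.
  have n0 : 0 < n%:R :> R by rewrite ltr0n ltnW.
  rewrite -ler_ln ?posrE ?exprn_gt0 // !lnXn // -[leLHS]mulr_natl -[leRHS]mulr_natl.
  rewrite -ler_pdivrMr //; apply: le_trans kq; rewrite ler_pdivlMl //.
  by apply: le_trans kbig; rewrite le_eqVlt; apply/orP; left; apply/eqP; field; rewrite gt_eqF.
have KT : (K < #|T|)%N by rewrite -(ltr_nat R); apply: lt_trans Kk kT.
have robustK (S : {set T}) : (#|S| <= K)%N -> connected_without G S.
  by move=> SK; apply: robust; apply: le_lt_trans Kk; rewrite ler_nat.
have big : 120%:R * #|T|%:R ^+ 3 < 2 ^+ (2 * q) :> R.
  rewrite Tn; have n13 : 2 ^+ 13 <= n%:R ^+ 13 :> R by apply: lerXn2r; rewrite ?nnegrE ?ler_nat.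
  have n3 : 0 < n%:R ^+ 3 :> R by rewrite exprn_gt0 // ltr0n ltnW.
  have two13 : 8192%:R <= 2 ^+ 13 :> R by rewrite -natrX ler_nat.
  have : 8192%:R * n%:R ^+ 3 <= 2 ^+ q.+1 :> R.
    apply: le_trans n16; rewrite (exprD _ 13 3) ler_wpM2r ?(ltW n3) //.
    exact: le_trans two13 n13.
  rewrite [2 ^+ q.+1]exprS; have : 2 ^+ q <= 2 ^+ (2 * q) :> R.
    by rewrite ler_eXn2l ?ltr1n // leq_pmull.
  by move=> le_q le_n; clear -n3 le_q le_n; lra.
have [H [sp bi rob]] := bipartite_of_size robustK KT qK big.
exists H; split=> //; split.
- by rewrite mulr_gt0 // invr_gt0.
- apply: le_lt_trans kT; rewrite mulrC ger_pMr // invf_le1 // ler1n.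
  by [].
- move=> S Sk; apply: rob; rewrite -ltnS -(ltr_nat R).
  exact: lt_le_trans Sk kq.
Qed.
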